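(* Let $\mathbf p=(p_1,\dots,p_{2^k})'$ be a feasible allocation with $f(\mathbf p)>0$. Then $\mathbf p$ is D-optimal if and only if for each $i=1,\dots,2^k$ one of the following two conditions is satisfied: (i) $p_i=0$ and $f_i\left(\tfrac12\right)\le \dfrac{d+2}{2^{d+1}}\,f(\mathbf p)$; (ii) $0<p_i\le \dfrac1{d+1}$ and $f_i(0)=\dfrac{1-p_i(d+1)}{(1-p_i)^{d+1}}\,f(\mathbf p)$.
   Context: Setting: $k\ge 1$ factors at two levels $\pm1$. The $2^k$ experimental conditions are the elements of $\{-1,1\}^k$, listed in some order. The model matrix $X$ is a $2^k\times(d+1)$ matrix with entries $\pm1$, $d\ge k$, whose $i$th row corresponds to the $i$th experimental condition $(x_1,\dots,x_k)$. Its first column is all ones (intercept); the other $d$ columns are distinct and consist of the $k$ main effects $x_1,\dots,x_k$ and, possibly, some interactions (products $\prod_{j\in S}x_j$ with $S\subseteq\{1,\dots,k\}$, $|S|\ge2$). Let $w_1,\dots,w_{2^k}\ge 0$ be given real constants. A feasible allocation (design) is $\mathbf p=(p_1,\dots,p_{2^k})'$ with $p_i\ge0$ and $\sum_i p_i=1$. Put $W=\mathrm{diag}\{w_1p_1,\dots,w_{2^k}p_{2^k}\}$ and $f(\mathbf p)=|X'WX|$ (determinant; $'$ is transpose; $f$ is defined by this formula). $\mathbf p$ is (locally) D-optimal if it maximizes $f$ over all feasible allocations. For $\mathbf p$ with $p_i<1$ (which holds for all $i$ when $f(\mathbf p)>0$), define for $0\le z\le1$ $$f_i(z)=f\left(\tfrac{1-z}{1-p_i}p_1,\dots,\tfrac{1-z}{1-p_i}p_{i-1},\,z,\,\tfrac{1-z}{1-p_i}p_{i+1},\dots,\tfrac{1-z}{1-p_i}p_{2^k}\right).$$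 *)

(* Defs.v *)
From mathcomp Require Import all_boot all_order all_algebra.
From mathcomp Require Import reals.

Set Implicit Arguments.
Unset Strict Implicit.
Unset Printing Implicit Defensive.

Import Order.TTheory GRing.Theory Num.Theory.

Local Open Scope ring_scope.

(* Row i of x is the i-th experimental condition: the rows list every element
   of {-1, 1}^k, each exactly once. *)
Definition lists_conditions (R : realType) (k : nat) (x : 'M[R]_((2 ^ k)%N, k))
  : Prop :=
  injective (fun i => row i x) /\
  (forall v : 'rV[R]_k,
     (exists i, row i x = v) <-> (forall j, v 0 j = -1 \/ v 0 j = 1)).

Definition main_effect (R : realType) (n k : nat) (x : 'M[R]_(n, k))
  (j : 'I_k) : 'cV[R]_n := \col_i x i j.

Definition interaction (R : realType) (n k : nat) (x : 'M[R]_(n, k))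
  (S : {set 'I_k}) : 'cV[R]_n := \col_i \prod_(j in S) x i j.

(* Column ord0 is the intercept; columns lift ord0 c, c : 'I_d, are the
   remaining d ones. *)
Definition model_matrix (R : realType) (n k d : nat) (x : 'M[R]_(n, k))
  (X : 'M[R]_(n, d.+1)) : Prop :=
  [/\ col ord0 X = const_mx 1,
      injective (fun c : 'I_d => col (lift ord0 c) X),
      forall j : 'I_k, exists c : 'I_d, col (lift ord0 c) X = main_effect x j
    & forall c : 'I_d,
        (exists j : 'I_k, col (lift ord0 c) X = main_effect x j) \/
        (exists2 S : {set 'I_k},
           (2 <= #|S|)%N & col (lift ord0 c) X = interaction x S)].

Definition feasible (R : realType) (n : nat) (p : 'rV[R]_n) : Prop :=
  (forall i, 0 <= p 0 i) /\ \sum_i p 0 i = 1.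

Definition weight_mx (R : realType) (n : nat) (w p : 'rV[R]_n) : 'M[R]_n :=
  diag_mx (\row_i (w 0 i * p 0 i)).

Definition obj (R : realType) (n d : nat) (X : 'M[R]_(n, d.+1))
  (w p : 'rV[R]_n) : R :=
  \det (X^T *m weight_mx w p *m X).

Definition D_optimal (R : realType) (n d : nat) (X : 'M[R]_(n, d.+1))
  (w p : 'rV[R]_n) : Prop :=
  feasible p /\ (forall q, feasible q -> obj X w q <= obj X w p).

(* Meaningful only when p 0 i < 1 (automatic when the determinant is positive
   and 1 <= d); at p 0 i = 1 the total division gives a junk
   value. *)
Definition realloc (R : realType) (n : nat) (p : 'rV[R]_n) (i : 'I_n) (z : R)
  : 'rV[R]_n :=
  \row_j (if j == i then z else (1 - z) / (1 - p 0 i) * p 0 j).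

Definition obj_at (R : realType) (n d : nat) (X : 'M[R]_(n, d.+1))
  (w p : 'rV[R]_n) (i : 'I_n) (z : R) : R :=
  obj X w (realloc p i z).

(* Main.v *)
Require Import Defs.
From mathcomp Require Import all_boot all_order all_algebra.
From mathcomp Require Import reals.
From mathcomp Require Import ring lra.

Import Order.TTheory GRing.Theory Num.Theory.

Local Open Scope ring_scope.

(** Write M for the information matrix X' W X of p, x_i for the i-th row of X
    and g_i = w_i x_i M^-1 x_i' for the sensitivity of p at condition i.  Two
    facts about these numbers prove the theorem.

    First, reallocating weight along condition i replaces M by a multiple c M
    plus a rank-one matrix, so the matrix determinant lemma gives the objective
    in closed form: f(c p + a e_i) = f(p) c^d (c + a g_i) ([obj_shift]).
    Substituting z = 1/2 when p_i = 0, the inequality in (i) becomes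
    g_i <= d + 1; substituting z = 0 when p_i > 0, the equation in (ii) becomes
    g_i = d + 1 ([test_unsupported], [test_supported]).

    Second, p is D-optimal if and only if g_i <= d + 1 for every i, which is the
    Kiefer-Wolfowitz equivalence theorem ([D_optimal_score]).  If some
    g_i > d + 1, moving a little weight to i increases f, by Bernoulli's
    inequality.  Conversely, for any competitor q with information matrix N,
    tr (N M^-1) = sum_i q_i g_i <= d + 1, and the arithmetic-geometric mean
    inequality for positive definite pairs,
    det N <= det M (tr (N M^-1) / (d + 1))^(d + 1) ([posdef_det_le_tr]), gives
    f(q) <= f(p).  The latter needs no eigenvalues: a Cholesky factor turns M
    into the identity, and then Hadamard's inequality bounds det N by the
    product of the diagonal of N.

    The two facts fit together because sum_i p_i g_i = tr (M M^-1) = d + 1: when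
    all g_i <= d + 1, equality must hold wherever p_i > 0 ([supported_score]).
    The bound p_i <= 1 / (d + 1) in (ii) is p_i g_i <= 1, a consequence of
    M >= w_i p_i x_i' x_i ([mul_score_le1]). *)

(** * Positive definite matrices *)

Definition posdef {R : realFieldType} {n : nat} (M : 'M[R]_n) : Prop :=
  M^T = M /\ forall v : 'rV_n, v != 0 -> 0 < (v *m M *m v^T) 0 0.

Lemma posdef_congr {R : realFieldType} {n : nat} (V M : 'M[R]_n) :
  V \in unitmx -> posdef M -> posdef (V *m M *m V^T).
Proof.
move=> uV [symM posM]; split=> [|v vn0]; first by rewrite !trmx_mul trmxK symM mulmxA.
have /posM : v *m V != 0.
  by apply: contraNneq vn0 => vV0; rewrite -[v](mulmxK uV) vV0 mul0mx.
by rewrite trmx_mul !mulmxA.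
Qed.

Lemma posdef_diag {R : realFieldType} {n : nat} (M : 'M[R]_n) (i : 'I_n) :
  posdef M -> 0 < M i i.
Proof.
move=> [_ /(_ (delta_mx 0 i))]; rewrite trmx_delta -rowE -colE !mxE; apply.
by apply/eqP => /matrixP/(_ 0 i)/eqP; rewrite !mxE !eqxx oner_eq0.
Qed.

Lemma posdef_drblock {R : realFieldType} {m n : nat} (A : 'M[R]_m) (B : 'M_(m, n))
    (C : 'M_(n, m)) (D : 'M_n) :
  posdef (block_mx A B C D) -> posdef D.
Proof.
move=> [symM posM]; split.
  by move: symM; rewrite tr_block_mx => /eq_block_mx[].
move=> v vn0; have /posM : row_mx (0 : 'rV_m) v != 0.
  by apply: contraNneq vn0; rewrite -row_mx0 => /eq_row_mx[_ ->].
by rewrite mul_row_block tr_row_mx mul_row_col !mul0mx trmx0 mulmx0 !add0r.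
Qed.

(** One step of symmetric Gaussian elimination: clearing the first row and
    column leaves the Schur complement S.  Its diagonal can only decrease,
    because S is obtained by subtracting a rank-one square; this is what makes
    Hadamard's inequality follow by induction. *)
Lemma posdef_pivot {R : realFieldType} {n : nat} (M : 'M[R]_(1 + n)) :
  posdef M ->
  exists (V : 'M_(1 + n)) (S : 'M_n),
    [/\ \det V = 1, posdef S, V *m M *m V^T = block_mx (M 0 0)%:M 0 0 S
      & forall i, S i i <= M (rshift 1 i) (rshift 1 i)].
Proof.
move=> pM; have a_gt0 : 0 < M 0 0 by exact: posdef_diag.
have an0 := lt0r_neq0 a_gt0.
set a := M 0 0 in a_gt0 an0 *; set b := ursubmx M; set C := drsubmx M.
have ME : M = block_mx a%:M b b^T C.
  rewrite -{1}(submxK M); congr block_mx.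
    by apply/matrixP => i j; rewrite !ord1 !mxE mulr1n; congr (M _ _); apply: val_inj.
  by rewrite /b trmx_ursub (proj1 pM).
pose V : 'M[R]_(1 + n) := block_mx 1%:M 0 (- a^-1 *: b^T) 1%:M.
pose S := C - a^-1 *: (b^T *m b).
have detV : \det V = 1 by rewrite det_lblock !det1 mulr1.
have VMV : V *m M *m V^T = block_mx a%:M 0 0 S.
  rewrite ME tr_block_mx !mulmx_block linearZ /= trmxK !trmx1 !trmx0.
  rewrite !mul1mx !mul0mx !mulmx0 !mulmx1 !addr0 -!scalemxAl -scalemxAr.
  rewrite mul_mx_scalar mul_scalar_mx !scalerA mulNr mulVf //.
  by rewrite !scaleN1r !addNr mul0mx add0r scaleNr addrC.
exists V, S; split=> //.
  apply: (@posdef_drblock _ 1 n a%:M 0 0); rewrite -VMV.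
  by apply: posdef_congr; rewrite // unitmxE detV unitr1.
move=> i; rewrite !mxE big_ord1 !mxE gerBl.
by rewrite pmulr_rge0 ?invr_gt0 // -expr2 sqr_ge0.
Qed.

Lemma posdef_hadamard {R : realFieldType} {n : nat} (M : 'M[R]_n) :
  posdef M -> 0 < \det M <= \prod_i M i i.
Proof.
elim: n M => [|n IHn] M pM; first by rewrite det_mx00 big_ord0 ltr01 lexx.
have a_gt0 : 0 < M 0 0 by exact: posdef_diag.
have [V [S [detV pS VMV leSM]]] := @posdef_pivot R n M pM.
have /andP[S_gt0 leS] := IHn S pS.
have -> : \det M = M 0 0 * \det S.
  have := congr1 determinant VMV.
  by rewrite (@det_ublock _ 1 n) det_scalar1 !det_mulmx det_tr detV mul1r mulr1.
rewrite mulr_gt0 // big_ord_recl ler_pM2l //=; apply: (le_trans leS).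
apply: ler_prod => i _; rewrite ltW ?posdef_diag //=.
by rewrite -[lift ord0 i]rshift1; apply: leSM.
Qed.

(** A congruence sending M to the identity is the inverse of a Cholesky factor;
    it is built by normalizing each pivot with a square root. *)
Lemma posdef_cholesky {R : rcfType} {n : nat} (M : 'M[R]_n) :
  posdef M -> exists U : 'M_n, U *m M *m U^T = 1%:M.
Proof.
elim: n M => [|n IHn] M pM; first by exists 0; rewrite [LHS]flatmx0 [RHS]flatmx0.
have a_gt0 : 0 < M 0 0 by exact: posdef_diag.
have [V [S [_ pS VMV _]]] := @posdef_pivot R n M pM.
have [U USU] := IHn S pS.
pose s := (Num.sqrt (M 0 0))^-1.
pose D : 'M[R]_(1 + n) := block_mx s%:M 0 0 U.
have DAD : D *m block_mx (M 0 0)%:M 0 0 S *m D^T = 1%:M.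
  rewrite tr_block_mx !mulmx_block !trmx0 !mul0mx !mulmx0 !addr0 !add0r.
  rewrite !mul0mx USU tr_scalar_mx -!scalar_mxM.
  have -> : s * M 0 0 * s = 1.
    have rn0 : Num.sqrt (M 0 0) != 0 by rewrite sqrtr_eq0 -ltNge.
    by rewrite -[M 0 0](sqr_sqrtr (ltW a_gt0)) /s; field.
  by rewrite (@scalar_mx_block R 1 n).
exists (D *m V); rewrite trmx_mul !mulmxA -(mulmxA D) -(mulmxA D) VMV.
exact: DAD.
Qed.

(** With U M U' = 1, the quotient det N / det M is the determinant of U N U',
    whose trace is tr (N M^-1).  Hadamard's inequality bounds that determinant
    by a product of n positive numbers, and the arithmetic-geometric mean
    inequality bounds the product by the trace. *)
Lemma posdef_det_le_tr {R : rcfType} {n : nat} (M N : 'M[R]_n) :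
  posdef M -> posdef N ->
  \det N <= \det M * (\tr (N *m invmx M) / n%:R) ^+ n.
Proof.
move=> pM pN; have [U UMU] := posdef_cholesky M pM.
have MUU : M *m (U^T *m U) = 1%:M.
  by rewrite mulmxA; apply: mulmx1C; rewrite mulmxA.
have uM : M \in unitmx by case: (mulmx1_unit MUU).
have invM : invmx M = U^T *m U by rewrite -[RHS](mulKmx uM) MUU mulmx1.
have uU : U \in unitmx by move: UMU; rewrite -mulmxA => /mulmx1_unit[].
have pUNU := posdef_congr U N uU pN.
have detM : \det M * \det U ^+ 2 = 1.
  by rewrite -(det1 _ n) -UMU !det_mulmx det_tr; ring.
have /andP[M_gt0 _] := posdef_hadamard M pM.
have -> : \det N = \det M * \det (U *m N *m U^T).
  by rewrite -[LHS]mulr1 -detM !det_mulmx det_tr; ring.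
rewrite ler_pM2l // invM mulmxA mxtrace_mulC mulmxA.
have /andP[_ le_had] := posdef_hadamard _ pUNU.
apply: (le_trans le_had).
have /leif_le := @leif_AGM R _ 'I_n (fun i => (U *m N *m U^T) i i)
  (fun i _ => ltW (posdef_diag _ i pUNU)).
by rewrite card_ord => amgm; apply: amgm.
Qed.

(** * Determinants of rank-one perturbations *)

(** Conjugation by the unipotent block matrix [1, 0; v, 1] carries
    [1 + uv, u; 0, 1] to [1, u; 0, 1 + vu]. *)
Lemma det1_add_rank1 {R : comNzRingType} {n : nat} (u : 'cV[R]_n) (v : 'rV[R]_n) :
  \det (1%:M + u *m v) = 1 + (v *m u) 0 0.
Proof.
have /(congr1 determinant) : block_mx 1%:M 0 v 1%:M *m block_mx (1%:M + u *m v) u 0 1%:M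
    = block_mx 1%:M u 0 (1%:M + v *m u) *m block_mx 1%:M 0 v 1%:M.
  rewrite !mulmx_block !mul1mx !mul0mx !mulmx1 !addr0 !add0r.
  by rewrite mulmxDr mulmxDl mulmx1 mul1mx mulmxA [v *m u + _]addrC.
rewrite !det_mulmx !det_lblock !det_ublock !det1 !mul1r !mulr1 => ->.
by rewrite det_mx11 !mxE.
Qed.

Lemma det_scale_add_rank1 {R : fieldType} {n : nat} (M : 'M[R]_n.+1) (c a : R)
    (u : 'rV[R]_n.+1) :
  M \in unitmx -> c != 0 ->
  \det (c *: M + a *: (u^T *m u))
  = \det M * c ^+ n * (c + a * (u *m invmx M *m u^T) 0 0).
Proof.
move=> uM cn0.
have -> : c *: M + a *: (u^T *m u)
    = (c *: M) *m (1%:M + (invmx M *m u^T) *m ((a / c) *: u)).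
  rewrite mulmxDr mulmx1 -!scalemxAr -!scalemxAl scalerA divfK //.
  by rewrite !mulmxA mulmxV // mul1mx.
rewrite det_mulmx detZ det1_add_rank1 -scalemxAl mulmxA !mxE exprS.
by field.
Qed.

(** * Information matrix and sensitivities *)

Definition info {R : realType} {n d : nat} (X : 'M[R]_(n, d.+1)) (w p : 'rV[R]_n)
  : 'M[R]_d.+1 := X^T *m weight_mx w p *m X.

(** The sensitivity of the design at condition i; it is the directional
    derivative of log det (info X w p) towards the i-th vertex, plus d + 1. *)
Definition score {R : realType} {n d : nat} (X : 'M[R]_(n, d.+1)) (w p : 'rV[R]_n)
  (i : 'I_n) : R := w 0 i * (row i X *m invmx (info X w p) *m (row i X)^T) 0 0.

Section Design.

Context {R : realType} {n d : nat} (X : 'M[R]_(n, d.+1)) (w : 'rV[R]_n).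
Implicit Types p q : 'rV[R]_n.

Lemma infoE p : info X w p = \sum_i (w 0 i * p 0 i) *: ((row i X)^T *m row i X).
Proof.
rewrite /info /weight_mx mul_mx_diag; apply/matrixP => a b.
rewrite summxE !mxE; apply: eq_bigr => i _.
by rewrite !mxE big_ord1 !mxE; ring.
Qed.

Lemma info_quad p (v : 'rV[R]_d.+1) :
  (v *m info X w p *m v^T) 0 0
  = \sum_i w 0 i * p 0 i * ((v *m (row i X)^T) 0 0) ^+ 2.
Proof.
rewrite infoE mulmx_sumr mulmx_suml summxE; apply: eq_bigr => i _.
rewrite -scalemxAr -scalemxAl mxE; congr (_ * _).
rewrite mulmxA -(mulmxA _ _ v^T).
have -> : row i X *m v^T = (v *m (row i X)^T)^T by rewrite trmx_mul trmxK.
by rewrite mxE big_ord1 expr2 [X in _ * X]mxE.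
Qed.

Lemma info_sym p : (info X w p)^T = info X w p.
Proof. by rewrite /info !trmx_mul trmxK tr_diag_mx mulmxA. Qed.

(** The quadratic form is a weighted sum of the squares of v x_i'.  If it
    vanishes, then so does every weighted v x_i', hence v M = 0, which the
    invertibility of M excludes. *)
Lemma info_posdef p :
  (forall i, 0 <= w 0 i) -> (forall i, 0 <= p 0 i) -> obj X w p != 0 ->
  posdef (info X w p).
Proof.
move=> w_ge0 p_ge0 f_neq0; split=> [|v v_neq0]; first exact: info_sym.
have uM : info X w p \in unitmx by rewrite unitmxE unitfE.
have quad_ge0 i : 0 <= w 0 i * p 0 i * ((v *m (row i X)^T) 0 0) ^+ 2.
  by rewrite mulr_ge0 ?sqr_ge0 // mulr_ge0.
rewrite info_quad lt_def sumr_ge0 // andbT.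
apply: contraNneq v_neq0 => /(psumr_eq0P (fun i _ => quad_ge0 i)) quad0.
rewrite -[v](mulmxK uM) infoE mulmx_sumr big1 ?mul0mx // => i _.
have /eqP := quad0 i isT; rewrite mulf_eq0 expf_eq0 /= => /orP[/eqP->|/eqP vi0].
  by rewrite scale0r mulmx0.
by rewrite -scalemxAr mulmxA [v *m _]mx11_scalar vi0 raddf0 mul0mx scaler0.
Qed.

Lemma tr_info_invmx p q :
  \tr (info X w q *m invmx (info X w p)) = \sum_i q 0 i * score X w p i.
Proof.
rewrite {1}infoE mulmx_suml raddf_sum /=; apply: eq_bigr => i _.
rewrite -scalemxAl linearZ /= -mulmxA mxtrace_mulC /mxtrace big_ord1 /score.
by ring.
Qed.

Lemma sum_score p :
  obj X w p != 0 -> \sum_i p 0 i * score X w p i = d.+1%:R.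
Proof.
by move=> f_neq0; rewrite -tr_info_invmx mulmxV ?mxtrace1 // unitmxE unitfE.
Qed.

(** Along these rays the information matrix is c M plus a rank-one term, which
    makes the objective an explicit function of c, a and the sensitivity. *)
Lemma obj_shift p q (i : 'I_n) (c a : R) :
  obj X w p != 0 -> c != 0 ->
  (forall j, q 0 j = c * p 0 j + a * (j == i)%:R) ->
  obj X w q = obj X w p * c ^+ d * (c + a * score X w p i).
Proof.
move=> f_neq0 c_neq0 qE.
have uM : info X w p \in unitmx by rewrite unitmxE unitfE.
have -> : obj X w q
    = \det (c *: info X w p + (a * w 0 i) *: ((row i X)^T *m row i X)).
  rewrite /obj -/(info X w q); congr (\det _); rewrite !infoE scaler_sumr.
  rewrite (bigD1 i) //= [in RHS](bigD1 i) //= addrAC qE eqxx.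
  rewrite !scalerA -scalerDl; congr (_ *: _ + _); first by rewrite mulr1; ring.
  apply: eq_bigr => j ji; rewrite scalerA qE (negPf ji) mulr0 addr0; congr (_ *: _); ring.
by rewrite det_scale_add_rank1 // /score mulrA.
Qed.

Lemma invinfo_quad p (u : 'rV[R]_d.+1) : obj X w p != 0 ->
  let v := u *m invmx (info X w p) in
  (v *m u^T) 0 0 = (v *m info X w p *m v^T) 0 0.
Proof.
move=> f_neq0 v; have uM : info X w p \in unitmx by rewrite unitmxE unitfE.
by rewrite /v mulmxKV // trmx_mul trmx_inv info_sym mulmxA.
Qed.

Lemma score_ge0 p (i : 'I_n) :
  (forall i, 0 <= w 0 i) -> (forall i, 0 <= p 0 i) -> obj X w p != 0 ->
  0 <= score X w p i.
Proof.
move=> w_ge0 p_ge0 f_neq0; rewrite /score invinfo_quad // info_quad.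
by rewrite mulr_ge0 // sumr_ge0 // => j _; rewrite mulr_ge0 ?sqr_ge0 // mulr_ge0.
Qed.

(** Keeping only the i-th square in the quadratic form of M at v = x_i M^-1 gives
    w_i p_i s^2 <= s for s = x_i M^-1 x_i'; dividing by s, when it is nonzero,
    gives the claim. *)
Lemma mul_score_le1 p (i : 'I_n) :
  (forall i, 0 <= w 0 i) -> (forall i, 0 <= p 0 i) -> obj X w p != 0 ->
  p 0 i * score X w p i <= 1.
Proof.
move=> w_ge0 p_ge0 f_neq0.
pose v := row i X *m invmx (info X w p); pose s := (v *m (row i X)^T) 0 0.
have sE : s = (v *m info X w p *m v^T) 0 0 by exact: invinfo_quad.
have wp_ge0 : 0 <= w 0 i * p 0 i by rewrite mulr_ge0.
have wps2_le : w 0 i * p 0 i * s ^+ 2 <= s.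
  rewrite [leRHS]sE info_quad (bigD1 i) //= lerDl.
  by apply: sumr_ge0 => j _; rewrite mulr_ge0 ?sqr_ge0 // mulr_ge0.
rewrite /score -/v -/s mulrA [p 0 i * _]mulrC.
have s_ge0 : 0 <= s by apply: le_trans wps2_le; rewrite mulr_ge0 ?sqr_ge0.
have [->|s_neq0] := eqVneq s 0; first by rewrite mulr0 ler01.
have s_gt0 : 0 < s by rewrite lt_def s_neq0.
by rewrite -(ler_pM2r s_gt0) mul1r -mulrA -expr2.
Qed.

(** * The equivalence theorem *)

Lemma bernoulli_subr (t : R) (m : nat) : 0 <= t <= 1 -> 1 - m%:R * t <= (1 - t) ^+ m.
Proof.
move=> /andP[t_ge0 t_le1]; elim: m => [|m IHm]; first by rewrite expr0 mul0r subr0.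
by move: IHm; rewrite exprS -natr1; have := ler0n R m; nra.
Qed.

Lemma feasible_shift p (i : 'I_n) (t : R) :
  feasible p -> 0 <= t <= 1 ->
  feasible (\row_j ((1 - t) * p 0 j + t * (j == i)%:R)).
Proof.
move=> [p_ge0 p_sum] /andP[t_ge0 t_le1]; split=> [j|].
  by rewrite mxE addr_ge0 ?mulr_ge0 ?subr_ge0 ?ler0n.
under eq_bigr do rewrite mxE.
rewrite big_split /= -mulr_sumr p_sum -mulr_sumr (bigD1 i) //= eqxx.
by rewrite big1 ?addr0 ?mulr1 ?subrK // => j /negPf->.
Qed.

(** The Kiefer-Wolfowitz equivalence theorem.  Towards vertex i the objective is
    f(p) (1 - t)^d (1 - t + t g_i), with slope f(p) (g_i - d - 1) at t = 0, so
    optimality forces g_i <= d + 1; the converse is the trace bound on the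
    determinant of the competitor. *)
Lemma D_optimal_score p :
  (forall i, 0 <= w 0 i) -> feasible p -> 0 < obj X w p ->
  D_optimal X w p <-> (forall i, score X w p i <= d.+1%:R).
Proof.
move=> w_ge0 fp f_gt0; have f_neq0 := lt0r_neq0 f_gt0.
have [p_ge0 p_sum] := fp.
split=> [[_ opt] i|score_le].
  rewrite leNgt; apply/negP => gm.
  set g := score X w p i in gm.
  have d_ge0 : 0 <= d%:R :> R by exact: ler0n.
  have gd : 0 < g - 1 - d%:R by move: gm; rewrite -natr1; lra.
  (* Bernoulli bounds the gain at step t below by
     t ((g - 1 - d) - d t (g - 1)); this t keeps it positive and is below 1. *)
  pose t := (g - 1 - d%:R) / (2 * d.+1%:R * (g - 1)).
  have den_gt0 : 0 < 2 * d.+1%:R * (g - 1).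
    by rewrite !mulr_gt0 ?ltr0n //; lra.
  have t_gt0 : 0 < t by exact: divr_gt0.
  have tE : t * (2 * d.+1%:R * (g - 1)) = g - 1 - d%:R by rewrite divfK ?lt0r_neq0.
  have t_lt1 : t < 1.
    rewrite ltr_pdivrMr // mul1r -natr1; nra.
  have := opt _ (feasible_shift p i t fp _).
  rewrite (ltW t_gt0) (ltW t_lt1) => /(_ isT).
  rewrite (obj_shift p _ i (1 - t) t) ?subr_eq0 ?gt_eqF //; last by move=> j; rewrite mxE.
  rewrite -mulrA -[leRHS]mulr1 ler_pM2l // leNgt => /negP; apply.
  have bern : 1 - d%:R * t <= (1 - t) ^+ d.
    by rewrite bernoulli_subr // !ltW.
  have : (1 - d%:R * t) * (1 - t + t * g) <= (1 - t) ^+ d * (1 - t + t * g).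
    apply: ler_wpM2r => //; nra.
  apply: lt_le_trans.
  have -> : (1 - d%:R * t) * (1 - t + t * g)
     = 1 + t * ((g - 1 - d%:R) - d%:R * t * (g - 1)) by ring.
  rewrite ltrDl mulr_gt0 // -tE -natr1.
  have : 0 < t * (g - 1) by rewrite mulr_gt0 //; lra.
  nra.
split=> // q [q_ge0 q_sum].
(* A competitor with a singular information matrix is beaten outright; the
   others have a positive definite one. *)
have [q_le0|q_gt0] := lerP (obj X w q) 0; first exact: le_trans q_le0 (ltW f_gt0).
have pMp := info_posdef p w_ge0 p_ge0 f_neq0.
have pMq := info_posdef q w_ge0 q_ge0 (lt0r_neq0 q_gt0).
apply: (le_trans (posdef_det_le_tr _ _ pMp pMq)).
rewrite -[leRHS]mulr1 ler_pM2l // tr_info_invmx.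
apply: exprn_ile1.
  by rewrite divr_ge0 ?ler0n // sumr_ge0 // => j _; rewrite mulr_ge0 // score_ge0.
rewrite ler_pdivrMr ?ltr0n // mul1r.
have -> : d.+1%:R = \sum_j q 0 j * d.+1%:R :> R.
  by rewrite -mulr_suml q_sum mul1r.
by apply: ler_sum => j _; apply: ler_wpM2l.
Qed.

(** * The reallocation tests *)

Lemma obj_realloc p (i : 'I_n) (z : R) :
  obj X w p != 0 -> p 0 i != 1 -> z != 1 ->
  obj_at X w p i z
  = obj X w p * ((1 - z) / (1 - p 0 i)) ^+ d
    * ((1 - z) / (1 - p 0 i) + (z - (1 - z) / (1 - p 0 i) * p 0 i) * score X w p i).
Proof.
move=> f_neq0 pi_neq1 z_neq1; apply: obj_shift => // [|j].
  by rewrite mulf_neq0 ?invr_eq0 ?subr_eq0 // eq_sym.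
rewrite mxE; have [->|_] := eqVneq j i; rewrite ?mulr1 ?mulr0; ring.
Qed.

(** The average of the sensitivities under p is d + 1, so if none exceeds this
    average then all those that p weighs are equal to it. *)
Lemma supported_score p (i : 'I_n) :
  (forall i, score X w p i <= d.+1%:R) -> feasible p -> obj X w p != 0 ->
  0 < p 0 i -> score X w p i = d.+1%:R.
Proof.
move=> score_le [p_ge0 p_sum] f_neq0 pi_gt0.
have gap_ge0 j : true -> 0 <= p 0 j * (d.+1%:R - score X w p j).
  by move=> _; rewrite mulr_ge0 // subr_ge0.
have gap_sum : \sum_j p 0 j * (d.+1%:R - score X w p j) = 0.
  under eq_bigr do rewrite mulrBr.
  by rewrite sumrB sum_score // -mulr_suml p_sum mul1r subrr.
have gap0 := psumr_eq0P gap_ge0 gap_sum; have /eqP := gap0 i isT.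
by rewrite mulf_eq0 gt_eqF //= subr_eq0 => /eqP.
Qed.

(** Here the reallocated objective is f(p) (1 + g_i) / 2^(d + 1). *)
Lemma test_unsupported p (i : 'I_n) :
  0 < obj X w p -> p 0 i = 0 ->
  (obj_at X w p i (1 / 2) <= (d + 2)%:R / 2 ^+ (d + 1) * obj X w p)
  = (score X w p i <= d.+1%:R).
Proof.
move=> f_gt0 pi0; have half_neq1 : 1 / 2 != 1 :> R by lra.
rewrite obj_realloc ?lt0r_neq0 ?pi0 // 1?eq_sym ?oner_neq0 //.
set f := obj X w p in f_gt0 *; set g := score X w p i.
have pow_gt0 : 0 < 2 ^+ d :> R by rewrite exprn_gt0.
have pow_neq0 := lt0r_neq0 pow_gt0.
have -> : (1 - 1 / 2) / (1 - 0) = 2^-1 :> R by field.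
have -> : f * 2^-1 ^+ d * (2^-1 + (1 / 2 - 2^-1 * 0) * g)
    = f / (2 * 2 ^+ d) * (1 + g).
  by rewrite exprVn; field.
have -> : (d + 2)%:R / 2 ^+ (d + 1) * f = f / (2 * 2 ^+ d) * (1 + d.+1%:R).
  by rewrite addn1 addn2 exprS -[d.+2%:R]natr1; field.
by rewrite ler_pM2l ?lerD2l // divr_gt0 // mulr_gt0.
Qed.

(** Here the reallocated objective is f(p) (1 - p_i g_i) / (1 - p_i)^(d + 1). *)
Lemma test_supported p (i : 'I_n) :
  obj X w p != 0 -> p 0 i != 0 -> p 0 i != 1 ->
  obj_at X w p i 0
    = (1 - p 0 i * (d + 1)%:R) / (1 - p 0 i) ^+ (d + 1) * obj X w p
  <-> score X w p i = d.+1%:R.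
Proof.
move=> f_neq0 pi_neq0 pi_neq1.
have q_neq0 : 1 - p 0 i != 0 by rewrite subr_eq0 eq_sym.
rewrite obj_realloc // 1?eq_sym ?oner_eq0 // addn1.
set f := obj X w p in f_neq0 *; set g := score X w p i.
set r := p 0 i in pi_neq0 pi_neq1 q_neq0 *.
have qd_neq0 : (1 - r) ^+ d != 0 by rewrite expf_neq0.
have -> : f * ((1 - 0) / (1 - r)) ^+ d
     * ((1 - 0) / (1 - r) + (0 - (1 - 0) / (1 - r) * r) * g)
   = (1 - r * g) / (1 - r) ^+ d.+1 * f.
  by rewrite subr0 mul1r exprVn exprS; field; rewrite qd_neq0.
split=> [eq|->//].
have c_neq0 : (1 - r) ^+ d.+1 != 0 by rewrite expf_neq0.
move: eq => /(mulIf f_neq0)/(mulIf (invr_neq0 c_neq0))/addrI/oppr_inj.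
exact: mulfI.
Qed.

End Design.

Theorem theorem3p1p1 (R : realType) (k d : nat)
  (x : 'M[R]_((2 ^ k)%N, k)) (X : 'M[R]_((2 ^ k)%N, d.+1))
  (w p : 'rV[R]_((2 ^ k)%N)) :
  (1 <= k)%N ->
  (k <= d)%N ->
  lists_conditions x ->
  model_matrix x X ->
  (forall i, 0 <= w 0 i) ->
  feasible p ->
  0 < obj X w p ->
  D_optimal X w p <->
  (forall i : 'I_(2 ^ k)%N,
     (p 0 i = 0 /\
      obj_at X w p i (1 / 2) <= (d + 2)%:R / 2 ^+ (d + 1) * obj X w p) \/
     ((0 < p 0 i /\ p 0 i <= 1 / (d + 1)%:R) /\
      obj_at X w p i 0
      = (1 - p 0 i * (d + 1)%:R) / (1 - p 0 i) ^+ (d + 1) * obj X w p)).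
Proof.
move=> k_ge1 le_kd _ _ w_ge0 fp f_gt0; have f_neq0 := lt0r_neq0 f_gt0.
have d_gt0 : (0 < d)%N by exact: leq_trans le_kd.
have [p_ge0 _] := fp.
have p_neq1 i : p 0 i <= 1 / (d + 1)%:R -> p 0 i != 1.
  move=> pi_le; rewrite lt_eqF // (le_lt_trans pi_le) //.
  by rewrite ltr_pdivrMr ?mul1r ?ltr1n ?ltr0n addn1.
rewrite D_optimal_score //; split=> [score_le i|test i].
  have [pi0|pi_neq0] := eqVneq (p 0 i) 0.
    by left; split=> //; rewrite test_unsupported.
  have pi_gt0 : 0 < p 0 i by rewrite lt_def pi_neq0 p_ge0.
  have g_eq := supported_score X w p i score_le fp f_neq0 pi_gt0.
  have pi_le : p 0 i <= 1 / (d + 1)%:R.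
    by rewrite addn1 ler_pdivlMr ?ltr0n // -g_eq mul_score_le1.
  by right; split=> //; apply/test_supported => //; apply: p_neq1.
have [[pi0 le_half]|[[pi_gt0 pi_le] eq0]] := test i.
  by rewrite -test_unsupported.
have /test_supported-> // := eq0; [exact: lt0r_neq0|exact: p_neq1].
Qed.
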